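(* Let $z>0$ and let $\mathbf{u}_z$ be the linear functional on polynomials given by $\langle \mathbf{u}_z,p\rangle=\int_0^\infty p(x)e^{-zx^4}\,dx$. Then $\mathbf{u}_z$ is semiclassical of class $3$. Moreover, $\mathbf{u}_z$ satisfies the Pearson equation $D(\phi\,\mathbf{u}_z)+\psi\,\mathbf{u}_z=\mathbf{0}$ with $\phi(x)=x$ and $\psi(x)=4zx^4-1$.
   Context: Let $\mathbb{P}$ be the linear space of polynomials in one variable with complex coefficients. For a linear functional $\mathbf{u}$ on $\mathbb{P}$ and $q\in\mathbb{P}$, define $q\mathbf{u}$ by $\langle q\mathbf{u},p\rangle=\langle\mathbf{u},qp\rangle$ and $D\mathbf{u}$ by $\langle D\mathbf{u},p\rangle=-\langle\mathbf{u},p'\rangle$, $p\in\mathbb{P}$. The functional $\mathbf{u}$ is quasi-definite if there is a sequence of monic polynomials $(P_n)_{n\ge 0}$ with $\deg P_n=n$ and $\langle\mathbf{u},P_nP_m\rangle=K_n\delta_{n,m}$, $K_n\neq 0$. A quasi-definite functional $\mathbf{u}$ is semiclassical if there exist non-zero polynomials $\phi,\psi$ with $\deg\phi\ge 0$, $\deg\psi\ge 1$ such that $D(\phi\mathbf{u})+\psi\mathbf{u}=\mathbf{0}$ (a Pearson equation). The class of a semiclassical functional $\mathbf{u}$ is $\mathfrak{s}(\mathbf{u})=\min\max\{\deg\phi-2,\deg\psi-1\}$, the minimum being over all such pairs $(\phi,\psi)$ for which the Pearson equation holds. *)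

(* Defs.v *)
From HB Require Import structures.
From mathcomp Require Import all_boot all_order all_algebra.
From mathcomp Require Import complex.
From mathcomp Require Import all_classical all_reals all_analysis.
From mathcomp Require Import measurable_realfun lebesgue_measure ring lra.

Set Implicit Arguments.
Unset Strict Implicit.
Unset Printing Implicit Defensive.

Import Order.TTheory GRing.Theory Num.Theory.
Import numFieldNormedType.Exports.

Local Open Scope classical_set_scope.
Local Open Scope complex_scope.
Local Open Scope ring_scope.

Section Functionals.
Variable F : fieldType.
Implicit Types (u : {scalar {poly F}}) (p q phi psi : {poly F}).

Definition poly_mul_functional q u p : F := u (q * p).

Fact poly_mul_functional_is_scalar q u : scalar (poly_mul_functional q u).
Proof.
by move=> a p r; rewrite /poly_mul_functional mulrDr -scalerAr linearP.
Qed.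

HB.instance Definition _ q u :=
  GRing.isLinear.Build F {poly F} F *%R (poly_mul_functional q u)
    (poly_mul_functional_is_scalar q u).

Definition derive_functional u p : F := - u p^`().

Fact derive_functional_is_scalar u : scalar (derive_functional u).
Proof.
by move=> a p r; rewrite /derive_functional linearP linearP opprD mulrN.
Qed.

HB.instance Definition _ u :=
  GRing.isLinear.Build F {poly F} F *%R (derive_functional u)
    (derive_functional_is_scalar u).

Definition quasi_definite u : Prop :=
  exists (P : nat -> {poly F}) (K : nat -> F),
    [/\ forall n, P n \is monic,
        forall n, size (P n) = n.+1,
        forall n, K n != 0 &
        forall n m, u (P n * P m) = K n * (n == m)%:R].

Definition pearson u phi psi : Prop :=
  derive_functional (poly_mul_functional phi u) \+ poly_mul_functional psi u
    =1 \0.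

(* Only meaningful for nonzero polynomials; the value at 0 is -1. *)
Definition deg p : int := (size p)%:Z - 1.

Definition pearson_pair u phi psi : Prop :=
  [/\ phi != 0, psi != 0, 0 <= deg phi, 1 <= deg psi & pearson u phi psi].

Definition semiclassical u : Prop :=
  quasi_definite u /\ exists phi psi, pearson_pair u phi psi.

Definition pearson_order phi psi : int := Num.max (deg phi - 2) (deg psi - 1).

(* [has_class u s]: the minimum defining the class of u exists and equals s. *)
Definition has_class u (s : int) : Prop :=
  (exists phi psi, pearson_pair u phi psi /\ pearson_order phi psi = s) /\
  (forall phi psi, pearson_pair u phi psi -> s <= pearson_order phi psi).

End Functionals.

Section QuarticFunctional.
Variable R : realType.
Implicit Types (z x : R) (p : {poly R[i]}).

Definition Cintegral (D : set R) (f : R -> R[i]) : R[i] :=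
  (\int[lebesgue_measure]_(x in D) complex.Re (f x))
    +i* (\int[lebesgue_measure]_(x in D) complex.Im (f x)).

(* For z <= 0 the integral diverges; carrying the otherwise unused proof of
   0 < z makes the linear instance below inferable. *)
Definition quartic_functional z (_ : 0 < z) p : R[i] :=
  Cintegral `[0, +oo[ (fun x => p.[x%:C] * (expR (- z * x ^+ 4))%:C).

Lemma measurable_monomial_weight (D : set R) z n :
  measurable_fun D (fun x => x ^+ n * expR (- z * x ^+ 4)).
Proof.
apply: measurable_funM; first exact: exprn_measurable.
apply: (measurableT_comp (f := expR)) => //.
apply: measurable_funM => //; exact: exprn_measurable.
Qed.

Lemma monomial_weight_le z (n : nat) : 0 < z ->
  exists C : R, forall x, 0 <= x ->
    x ^+ n * expR (- z * x ^+ 4) <= C * expR (- 1 * x).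
Proof.
move=> z0; pose a : R := 1 + 2 / z.
have a1 : 1 <= a by rewrite lerDl divr_ge0// ltW.
have az : 2 <= z * a by rewrite mulrDr mulr1 mulrC divfK ?gt_eqF// lerDr ltW.
exists (n`!%:R * expR (2 * a)) => x x0.
have xn : x ^+ n <= n`!%:R * expR x.
  case: n => [|n]; first by rewrite expr0 fact0 mul1r -expR0 ler_expR.
  rewrite mulrC -ler_pdivrMr ?ltr0n ?fact_gt0//.
  by apply: le_trans (expR_ge1Dxn n x0); rewrite lerDr.
have ez : expR (- z * x ^+ 4) <= expR (2 * a) * expR (- 2 * x).
  rewrite -expRD ler_expR.
  have [xa|/ltW ax] := leP x a.
    have : 0 <= z * x ^+ 4 by rewrite mulr_ge0 ?exprn_ge0// ltW.
    by move=> ?; lra.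
  have x1 : 1 <= x by exact: le_trans ax.
  have zx : 2 <= z * x by apply: le_trans az _; rewrite ler_pM2l.
  have x3 : 1 <= x ^+ 3 by rewrite exprn_ege1.
  have : 2 * x <= z * x ^+ 4.
    have -> : z * x ^+ 4 = z * x * x * x ^+ 2 by ring.
    have x2 : 1 <= x ^+ 2 by rewrite exprn_ege1.
    have h : 2 * x <= z * x * x by rewrite ler_wpM2r.
    apply: (le_trans h); rewrite ler_peMr//.
    by apply: le_trans h; rewrite mulr_ge0.
  by move=> ?; lra.
have -> : n`!%:R * expR (2 * a) * expR (- 1 * x) =
          (n`!%:R * expR x) * (expR (2 * a) * expR (- 2 * x)).
  have -> : - 1 * x = x + - 2 * x by ring.
  by rewrite expRD; ring.
by rewrite ler_pM ?exprn_ge0 ?expR_ge0.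
Qed.

Lemma integrable_monomial_weight z (n : nat) : 0 < z ->
  lebesgue_measure.-integrable `[0, +oo[
    (EFin \o (fun x => x ^+ n * expR (- z * x ^+ 4))).
Proof.
move=> z0; have [C hC] := monomial_weight_le n z0.
have iexp : lebesgue_measure.-integrable `[0, +oo[
    (fun x => C%:E * (EFin \o (exponential_pdf (1 : R))) x)%E.
  apply: integrableZl => //.
  apply: (integrableS (E := setT)) => //.
  exact: integrable_exponential_pdf.
apply: le_integrable iexp => //; first by apply/measurable_EFinP; exact: measurable_monomial_weight.
move=> x; rewrite /= in_itv/= andbT => x0.
rewrite lee_fin exponential_pdfE// mul1r.
have h0 : 0 <= x ^+ n * expR (- z * x ^+ 4).
  by rewrite mulr_ge0 ?exprn_ge0 ?expR_ge0.
have h := hC _ x0.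
by rewrite !ger0_norm// (le_trans h0).
Qed.

Lemma integrable_weight z (q : {poly R}) : 0 < z ->
  lebesgue_measure.-integrable `[0, +oo[
    (EFin \o (fun x => q.[x] * expR (- z * x ^+ 4))).
Proof.
move=> z0.
have -> : (EFin \o (fun x => q.[x] * expR (- z * x ^+ 4))) =
    (fun x => \sum_(k < size q)
       (q`_k)%:E * (EFin \o (fun x => x ^+ k * expR (- z * x ^+ 4))%R) x)%E.
  apply/funext => x /=; rewrite horner_coef mulr_suml -sumEFin.
  by apply: eq_bigr => k _; rewrite -mulrA EFinM.
pose f (k : nat) x := ((q`_k)%:E * (x ^+ k * expR (- z * x ^+ 4))%:E)%E.
refine (@integrable_sum _ _ R lebesgue_measure `[0, +oo[ _ _ _ xpredT
  (fun k : 'I_(size q) => f k) _) => //.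
move=> k _.
by apply: integrableZl => //; exact: integrable_monomial_weight.
Qed.

Lemma Re_weight p x (w : R) :
  complex.Re (p.[x%:C] * w%:C) = (map_poly (@complex.Re R) p).[x] * w.
Proof.
have ReM (c : R[i]) (r : R) : complex.Re (c * r%:C) = complex.Re c * r.
  by case: c => c d /=; rewrite mulr0 subr0.
rewrite ReM; congr (_ * _).
rewrite (horner_coef_wide _ (size_poly _ _)) horner_coef raddf_sum /=.
by apply: eq_bigr => k _; rewrite coef_map -rmorphXn ReM.
Qed.

Lemma Im_weight p x (w : R) :
  complex.Im (p.[x%:C] * w%:C) = (map_poly (@complex.Im R) p).[x] * w.
Proof.
have ImM (c : R[i]) (r : R) : complex.Im (c * r%:C) = complex.Im c * r.
  by case: c => c d /=; rewrite mulr0 add0r.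
rewrite ImM; congr (_ * _).
rewrite (horner_coef_wide _ (size_poly _ _)) horner_coef raddf_sum /=.
by apply: eq_bigr => k _; rewrite coef_map -rmorphXn ImM.
Qed.

Section Linearity.
Variables (z : R) (z_gt0 : 0 < z).

Let I (q : {poly R}) : R :=
  \int[lebesgue_measure]_(x in `[0, +oo[) (q.[x] * expR (- z * x ^+ 4)).

Let IP a (q r : {poly R}) : I (a *: q + r) = a * I q + I r.
Proof.
rewrite /I -RintegralZl//; last exact: integrable_weight.
rewrite -RintegralD//; last 2 first.
- apply: eq_integrable (integrable_weight (a *: q) z_gt0) => // x _ /=.
  by rewrite hornerZ -mulrA.
- exact: integrable_weight.
by apply: eq_Rintegral => x _; rewrite hornerD hornerZ mulrDl -mulrA.
Qed.

Lemma quartic_functionalE p : quartic_functional z_gt0 p =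
  I (map_poly (@complex.Re R) p) +i* I (map_poly (@complex.Im R) p).
Proof.
by congr (_ +i* _); apply: eq_Rintegral => x _; rewrite (Re_weight, Im_weight).
Qed.

Fact quartic_functional_is_scalar : scalar (quartic_functional z_gt0).
Proof.
move=> [a b] p q; rewrite !quartic_functionalE.
have -> : map_poly (@complex.Re R) ((a +i* b) *: p + q) =
    a *: map_poly (@complex.Re R) p +
    (- b *: map_poly (@complex.Im R) p + map_poly (@complex.Re R) q).
  apply/polyP => k; rewrite !(coefD, coefZ, coef_map) /=.
  by case: p`_k => c d; case: q`_k => e f /=; ring.
have -> : map_poly (@complex.Im R) ((a +i* b) *: p + q) =
    a *: map_poly (@complex.Im R) p +
    (b *: map_poly (@complex.Re R) p + map_poly (@complex.Im R) q).
  apply/polyP => k; rewrite !(coefD, coefZ, coef_map) /=.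
  by case: p`_k => c d; case: q`_k => e f /=; ring.
by rewrite !IP; apply/eqP; rewrite eq_complex /=; apply/andP; split;
  apply/eqP; ring.
Qed.

HB.instance Definition _ :=
  GRing.isLinear.Build R[i] {poly R[i]} R[i] *%R (quartic_functional z_gt0)
    quartic_functional_is_scalar.

End Linearity.
End QuarticFunctional.

(* Main.v *)
(* Write w(x) = exp(-z x^4).  Integration by parts on [0, +oo[ gives
   <u, q'> - 4z <u, x^3 q> = -q(0), and q = x p yields the Pearson equation.
   The real moment functional is positive, so Gram-Schmidt applied to it produces
   monic real orthogonal polynomials, which also serve the complex functional.
   For the class, a Pearson pair (phi, psi) satisfies
   <u, theta p> = -phi(0) p(0) for theta = psi + phi' - 4z x^3 phi and all p.
   Hence x theta annihilates u, so theta = 0, then phi(0) = 0, and phi being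
   nonzero has degree at least 1; therefore deg psi = deg phi + 3 >= 4. *)

Require Import Defs.
From HB Require Import structures.
From mathcomp Require Import all_boot all_order all_algebra.
From mathcomp Require Import complex.
From mathcomp Require Import all_classical all_reals all_analysis.
From mathcomp Require Import ring lra.

Set Implicit Arguments.
Unset Strict Implicit.
Unset Printing Implicit Defensive.

Import Order.TTheory GRing.Theory Num.Theory.
Import numFieldNormedType.Exports.
Local Open Scope classical_set_scope.
Local Open Scope complex_scope.
Local Open Scope ring_scope.

(** * Gram-Schmidt for an anisotropic functional *)

Lemma ex_orthogonal_projection (F : fieldType) (L : {scalar {poly F}}) :
  (forall q : {poly F}, L (q * q) = 0 -> q = 0) ->
  forall (n : nat) (p : {poly F}), exists2 q : {poly F}, (size q <= n)%N &
    forall s : {poly F}, (size s <= n)%N -> L ((p - q) * s) = 0.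
Proof.
move=> Ldef; elim=> [|n IH] p.
  exists 0; first by rewrite size_poly0.
  by move=> s; rewrite leqn0 size_poly_eq0 => /eqP->; rewrite mulr0 linear0.
have [r rn rorth] := IH 'X^n; have [q qn qorth] := IH p.
(* The residual [e] is the next orthogonal polynomial: monic of degree [n] and orthogonal to all
   lower degrees. The new projection of [p] adds its component along [e]; anisotropy makes the
   denominator [L (e * e)] nonzero. *)
pose e := 'X^n - r.
have szr : (size (- r) < size ('X^n : {poly F}))%N by rewrite size_polyN size_polyXn.
have sze : size e = n.+1 by rewrite /e size_polyDl// size_polyXn.
have en : e`_n = 1.
  by rewrite coefB coefXn eqxx nth_default ?subr0.
have Lee : L (e * e) != 0.
  by apply/eqP => /Ldef e0; move: sze; rewrite e0 size_poly0.
exists (q + (L ((p - q) * e) / L (e * e)) *: e).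
  rewrite (leq_trans (size_polyD _ _))// geq_max (leq_trans qn)//=.
  by rewrite (leq_trans (size_scale_leq _ _)) ?sze.
set c := _ / _ => s sn.
(* Subtracting the multiple of [e] drops the degree below [n], so [t] is orthogonal to both [e] and
   [p - q]; the two terms that remain cancel by the choice of [c]. *)
pose t := s - s`_n *: e.
have tn : (size t <= n)%N.
  apply/leq_sizeP => j; rewrite leq_eqVlt => /predU1P[<-|nj].
    by rewrite coefB coefZ en mulr1 subrr.
  rewrite coefB coefZ (nth_default _ (leq_trans sn nj)) [e`_j]nth_default ?sze//.
  by rewrite mulr0 subr0.
have -> : s = s`_n *: e + t by rewrite /t addrC subrK.
have -> : (p - (q + c *: e)) * (s`_n *: e + t) =
  s`_n *: ((p - q) * e) + (- (c * s`_n) *: (e * e) + (- c *: (e * t) + (p - q) * t)).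
  by rewrite -!mul_polyC !polyCN (polyCM c); ring.
rewrite !linearP (rorth _ tn) (qorth _ tn) /c.
by field.
Qed.

(** The residuals of ['X^n] modulo projection onto lower degrees are the orthogonal family: of two
    distinct ones, the lower-degree one is a test polynomial for the other. *)
Lemma anisotropic_quasi_definite (F : fieldType) (L : {scalar {poly F}}) :
  (forall q : {poly F}, L (q * q) = 0 -> q = 0) -> quasi_definite L.
Proof.
move=> Ldef.
have /choice[r /all_and2[rn rorth]] : forall n, exists r : {poly F},
    (size r <= n)%N /\
    (forall s : {poly F}, (size s <= n)%N -> L (('X^n - r) * s) = 0).
  move=> n; have [r ? ?] := ex_orthogonal_projection Ldef n 'X^n.
  by exists r.
pose P n := 'X^n - r n.
have lt_r n : (size (- r n) < size ('X^n : {poly F}))%N.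
  by rewrite size_polyN size_polyXn ltnS.
have sP n : size (P n) = n.+1 by rewrite /P size_polyDl// size_polyXn.
exists P, (fun n => L (P n * P n)); split=> // [n|n|n m].
- by rewrite monicE /P lead_coefDl// lead_coefXn.
- by apply/eqP => /Ldef P0; have := sP n; rewrite P0 size_poly0.
- have [->|] := eqVneq n m; first by rewrite mulr1.
  rewrite neq_ltn mulr0 => /orP[nm|mn]; last by rewrite rorth ?sP.
  by rewrite mulrC rorth ?sP.
Qed.

(** * Real multiples of complex numbers, and roots of a real polynomial *)

Section Complex.
Variable R : realType.

Lemma complexReM (c : R[i]) (r : R) : complex.Re (c * r%:C) = complex.Re c * r.
Proof. by case: c => c d /=; rewrite mulr0 subr0. Qed.

Lemma complexImM (c : R[i]) (r : R) : complex.Im (c * r%:C) = complex.Im c * r.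
Proof. by case: c => c d /=; rewrite mulr0 add0r. Qed.

End Complex.

Lemma countable_roots (R : realType) (q : {poly R}) :
  q != 0 -> countable [set x | root q x].
Proof.
move=> q0; apply: finite_set_countable.
(* An infinite root set would contain [size q] distinct roots, more than the degree allows. *)
apply: contrapT => /infinite_set_fset-/(_ (size q))[B Bq sB].
suff /(max_poly_roots q0)/(_ (finmap.fset_uniq B)) :
    all (root q) (finmap.enum_fset B) by rewrite ltnNge sB.
by apply/allP => x xB; exact: Bq.
Qed.

(** * Improper fundamental theorem of calculus under exponential domination *)

Section ImproperFTC.
Variable R : realType.

Lemma is_derive_expRN (C x : R) :
  is_derive x 1 (fun x => - C * expR (- 1 * x)) (C * expR (- 1 * x)).
Proof.
by apply: is_derive_eq; rewrite /GRing.scale/=; ring.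
Qed.

Lemma is_derive_continuous (f df : R -> R) :
  (forall x : R, is_derive x 1 f (df x)) -> continuous f.
Proof.
move=> dF x; apply: differentiable_continuous; apply/derivable1_diffP.
exact: ex_derive.
Qed.

Lemma cvgy_expRN (C : R) : C * expR (- 1 * x) @[x --> +oo] --> 0.
Proof.
rewrite -[0](mulr0 C); apply: cvgM; first exact: cvg_cst.
by under eq_fun do rewrite mulN1r; exact: cvgr_expR.
Qed.

Lemma Rintegral_dominated_FTC2y (f F : R -> R) (C : R) : 0 <= C ->
  continuous f -> (forall x : R, is_derive x 1 F (f x)) ->
  lebesgue_measure.-integrable `[0, +oo[ (EFin \o f) ->
  (forall x : R, 0 <= x -> `|f x| <= C * expR (- 1 * x)) ->
  F x @[x --> +oo] --> 0 ->
  \int[lebesgue_measure]_(x in `[0, +oo[) f x = - F 0.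
Proof.
move=> C0 cf dF fi fC F0.
(* Adding [e] makes the integrand nonnegative, as the library's improper FTC
   requires. *)
pose e (x : R) : R := C * expR (- 1 * x); pose E (x : R) : R := - C * expR (- 1 * x).
have dE (x : R) : is_derive x 1 E (e x) by exact: is_derive_expRN.
have ei : lebesgue_measure.-integrable `[0, +oo[ (EFin \o e).
  have : lebesgue_measure.-integrable `[0, +oo[
    (fun x => C%:E * (EFin \o (exponential_pdf (1 : R))) x)%E.
    apply: integrableZl => //.
    by apply: (integrableS (E := setT)) => //; exact: integrable_exponential_pdf.
  apply: eq_integrable => // x; rewrite inE/= in_itv/= andbT => x0.
  by rewrite /= exponential_pdfE// mul1r EFinM.
have ce : continuous e.
  move=> x; apply: differentiable_continuous; apply/derivable1_diffP.
  exact: ex_derive.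
have E0 : E x @[x --> +oo] --> 0 by exact: cvgy_expRN.
have FTC (g G : R -> R) : (forall x : R, 0 <= x -> 0 <= g x) -> continuous g ->
    (forall x : R, is_derive x 1 G (g x)) -> G x @[x --> +oo] --> 0 ->
    \int[lebesgue_measure]_(x in `[0, +oo[) g x = - G 0.
  move=> g0 cg dG G0; rewrite -[RHS]add0r.
  apply: Rintegral_ge0_continuous_FTC2y => //.
  - exact: continuous_subspaceT.
  - by apply: cvg_at_right_filter; exact: (is_derive_continuous dG).
  - by move=> x _; rewrite derive1E derive_val.
have -> : \int[lebesgue_measure]_(x in `[0, +oo[) f x =
    \int[lebesgue_measure]_(x in `[0, +oo[) ((f x + e x) - e x).
  by apply: eq_Rintegral => x _; rewrite addrK.
have fei : lebesgue_measure.-integrable `[0, +oo[ (EFin \o (fun x => f x + e x)).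
  exact: (integrableD _ fi ei).
have -> : - F 0 = - (F + E) 0 - - E 0 by have -> : (F + E) 0 = F 0 + E 0 by []; ring.
rewrite RintegralB//; congr (_ - _); apply: FTC => //.
- move=> x x0; have := fC x x0; rewrite ler_norml => /andP[+ _].
  by rewrite -/(e x); lra.
- by move=> x; apply: cvgD; [exact: cf|exact: ce].
- by rewrite -[0]addr0; apply: cvgD.
- by move=> x _; rewrite mulr_ge0 ?expR_ge0.
Qed.

End ImproperFTC.

(** * The real moment functional and its positivity *)

Section Moment.
Variables (R : realType) (z : R).
Hypothesis z_gt0 : 0 < z.

Definition moment (q : {poly R}) : R :=
  \int[lebesgue_measure]_(x in `[0, +oo[) (q.[x] * expR (- z * x ^+ 4)).

(** A real factor commutes with taking real and imaginary parts of coefficients. *)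
Lemma quartic_functional_real (q : {poly R}) (p : {poly R[i]}) :
  quartic_functional z_gt0 (p * map_poly (real_complex R) q) =
  moment (map_poly (@complex.Re R) p * q)
    +i* moment (map_poly (@complex.Im R) p * q).
Proof.
rewrite quartic_functionalE.
by congr (moment _ +i* moment _); apply/polyP => k;
  rewrite coef_map !coefM raddf_sum; apply: eq_bigr => j _;
  rewrite !coef_map /= (complexReM, complexImM).
Qed.

Lemma poly_weight_le (q : {poly R}) : exists C : R, 0 <= C /\ forall x, 0 <= x ->
  `|q.[x] * expR (- z * x ^+ 4)| <= C * expR (- 1 * x).
Proof.
(* The factor [x ^+ n] strengthens the claim for induction on [q * 'X + c%:P]: the new ['X] raises
   the exponent to [n.+1], and the constant falls under the monomial bound. *)
suff H (n : nat) : exists C : R, 0 <= C /\ forall x, 0 <= x ->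
    x ^+ n * `|q.[x] * expR (- z * x ^+ 4)| <= C * expR (- 1 * x).
  by have [C [C0 h]] := H 0; exists C; split=> // x /h; rewrite mul1r.
elim/poly_ind: q n => [|q c IH] n.
  exists 0; split=> // x _.
  by rewrite horner0 !mul0r normr0 mulr0.
have [C [C0 hC]] := IH n.+1; have [B hB] := monomial_weight_le n z_gt0.
have B0 : 0 <= B.
  have := hB 0 (lexx _); rewrite mulr0 expR0 mulr1; apply: le_trans.
  by rewrite mulr_ge0 ?exprn_ge0 ?expR_ge0.
exists (C + `|c| * B); split=> [|x x0]; first by rewrite addr_ge0// mulr_ge0.
rewrite hornerMXaddC !normrM (ger0_norm (expR_ge0 _)).
rewrite mulrDl -mulrA.
apply: le_trans (lerD (hC x x0) (ler_wpM2l (normr_ge0 c) (hB x x0))).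
rewrite normrM (ger0_norm (expR_ge0 _)).
set w := expR _; have -> : x ^+ n.+1 * (`|q.[x]| * w) + `|c| * (x ^+ n * w) =
  x ^+ n * ((`|q.[x]| * x + `|c|) * w) by rewrite exprS; ring.
rewrite ler_wpM2l ?exprn_ge0// ler_wpM2r ?expR_ge0//.
by rewrite (le_trans (ler_normD _ _))// normrM (ger0_norm x0).
Qed.

(** A nonnegative integrand with zero integral vanishes almost everywhere. As the weight is
    positive, a nonzero [q] would have the half-line covered by a null set and its countably many
    roots, contradicting infinite measure. *)
Lemma moment_sqr_eq0 q : moment (q * q) = 0 -> q = 0.
Proof.
move=> m0; apply/eqP/negPn/negP => q0.
pose f x : R := (q * q).[x] * expR (- z * x ^+ 4).
have f0 x : 0 <= f x by rewrite /f hornerM mulr_ge0 ?expR_ge0// -expr2 sqr_ge0.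
have fi : lebesgue_measure.-integrable `[0, +oo[ (EFin \o f).
  exact: integrable_weight.
have I0 : (\int[lebesgue_measure]_(x in `[0%R, +oo[) `|(EFin \o f) x| = 0)%E.
  under eq_integral do rewrite /= ger0_norm//.
  rewrite -(fineK (integrable_fin_num _ fi))//.
  by congr EFin.
have [/(_ I0) [N [mN N0 sN]] _] :=
  ae_eq_integral_abs lebesgue_measure (measurable_itv _) (measurable_int _ fi).
have croots := countable_roots q0.
have sub : (`[0, +oo[%classic : set R) `<=` N `|` [set x | root q x].
  move=> x x0; apply: contrapT => /not_orP[Nx rx]; apply: Nx; apply: sN => /= H.
  apply: rx; move/eqP: (H x0); rewrite /f eqe mulf_eq0 hornerM mulf_eq0 orbb.
  by rewrite (gt_eqF (expR_gt0 _)) orbF.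
have : lebesgue_measure (`[0, +oo[%classic : set R) = 0%E.
  apply: (measure_negligible (mu := lebesgue_measure)) => //.
  apply: (negligibleS (mu := lebesgue_measure) sub).
  apply: negligibleU; first exact/negligibleP.
  apply/negligibleP; last exact: countable_lebesgue_measure0.
  exact: countable_measurable.
by rewrite lebesgue_measure_itv/= ltry.
Qed.

Lemma momentE q :
  quartic_functional z_gt0 (map_poly (real_complex R) q) = (moment q)%:C.
Proof.
rewrite -[map_poly _ q]mul1r quartic_functional_real.
have -> : map_poly (@complex.Re R) 1 = 1 by rewrite -polyC1 map_polyC.
have -> : map_poly (@complex.Im R) 1 = 0 by rewrite -polyC1 map_polyC.
rewrite mul1r mul0r /moment; congr (_ +i* _).
by under eq_Rintegral do rewrite horner0 mul0r; rewrite Rintegral_cst// mul0r.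
Qed.

(** Linearity is inherited from [quartic_functional] through the injective embedding of the
    reals. *)
Lemma moment_is_scalar : scalar moment.
Proof.
move=> a p q; apply: (@complexI R).
rewrite -momentE rmorphD /= map_polyZ quartic_functional_is_scalar !momentE.
by rewrite rmorphD rmorphM.
Qed.

(** * Integration by parts *)

Lemma moment_deriv q :
  moment (q^`() - (4 * z) *: ('X^3 * q)) = - q.[0].
Proof.
have [C [C0 hC]] := poly_weight_le (q^`() - (4 * z) *: ('X^3 * q)).
have [B [B0 hB]] := poly_weight_le q.
(* The integrand is exactly the derivative of [F], which decays at infinity, so only the boundary
   value at 0 survives. *)
pose F (x : R) : R := q.[x] * expR (- z * x ^+ 4).
have -> : q.[0] = F 0 by rewrite /F expr0n/= mulr0 expR0 mulr1.
apply: (Rintegral_dominated_FTC2y C0) hC _.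
- move=> x; apply: differentiable_continuous; apply/derivable1_diffP.
  exact: ex_derive.
- move=> x; apply: is_derive_eq; rewrite !hornerE /GRing.scale/=; ring.
- exact: integrable_weight.
- apply: norm_cvg0; apply: (squeeze_cvgr _ (cvg_cst 0) (cvgy_expRN B)).
  by near=> x; rewrite normr_ge0 hB.
Unshelve. all: by end_near. Qed.

(** Since [4 * z] is real, every operation involved acts separately on real and imaginary parts, and
    the real identity applies to each. *)
Lemma quartic_functional_deriv (q : {poly R[i]}) :
  quartic_functional z_gt0 (q^`() - (4 * z)%:C *: ('X^3 * q)) = - q.[0].
Proof.
rewrite quartic_functionalE -!/(moment _).
have -> : map_poly (@complex.Re R) (q^`() - (4 * z)%:C *: ('X^3 * q)) =
    (map_poly (@complex.Re R) q)^`()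
    - (4 * z) *: ('X^3 * map_poly (@complex.Re R) q).
  apply/polyP => k; rewrite coef_map.
  rewrite !(coefD, coefN, coefZ, coef_deriv, coef_map, coefXnM) /=.
  rewrite raddfB raddfMn; congr (_ - _); case: ifP => _; first by rewrite !mulr0.
  by case: q`_(k - 3) => a b /=; ring.
have -> : map_poly (@complex.Im R) (q^`() - (4 * z)%:C *: ('X^3 * q)) =
    (map_poly (@complex.Im R) q)^`()
    - (4 * z) *: ('X^3 * map_poly (@complex.Im R) q).
  apply/polyP => k; rewrite coef_map.
  rewrite !(coefD, coefN, coefZ, coef_deriv, coef_map, coefXnM) /=.
  rewrite raddfB raddfMn; congr (_ - _); case: ifP => _; first by rewrite !mulr0.
  by case: q`_(k - 3) => a b /=; ring.
rewrite !moment_deriv !horner_coef0 !coef_map.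
by case: q`_0.
Qed.

(** * Nondegeneracy and quasi-definiteness over the complex numbers *)

Lemma quartic_functional_nondegenerate (r : {poly R[i]}) :
  (forall p, quartic_functional z_gt0 (r * p) = 0) -> r = 0.
Proof.
move=> r0.
(* Testing against the real polynomial [Re r] makes the moment of its square the real component;
   [Im r] does the same for the imaginary component. *)
have Re0 : map_poly (@complex.Re R) r = 0.
  apply: moment_sqr_eq0.
  by have := r0 (map_poly (real_complex R) (map_poly (@complex.Re R) r));
     rewrite quartic_functional_real => -[].
have Im0 : map_poly (@complex.Im R) r = 0.
  apply: moment_sqr_eq0.
  by have := r0 (map_poly (real_complex R) (map_poly (@complex.Im R) r));
     rewrite quartic_functional_real => -[].
apply/polyP => k; move/polyP/(_ k): Re0; move/polyP/(_ k): Im0.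
by rewrite !coef_map !coef0; case: r`_k => a b /= -> ->.
Qed.

(** Over [R[i]] a nonzero [p] can have [p * p] sent to 0, so the anisotropy criterion is applied to
    the real functional and its orthogonal polynomials are embedded. *)
Lemma quartic_functional_quasi_definite : quasi_definite (quartic_functional z_gt0).
Proof.
pose L : {scalar {poly R}} := HB.pack moment
  (GRing.isLinear.Build R {poly R} R *%R moment moment_is_scalar).
have [P [K [mP sP K0 PK]]] := anisotropic_quasi_definite (L := L) moment_sqr_eq0.
exists (fun n => map_poly (real_complex R) (P n)), (fun n => (K n)%:C); split.
- by move=> n; rewrite map_monic.
- by move=> n; rewrite size_map_poly.
- by move=> n; rewrite fmorph_eq0.
move=> n m; rewrite -rmorphM /= momentE.
have -> : moment (P n * P m) = K n * (n == m)%:R by exact: PK.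
by rewrite rmorphM /= rmorph_nat.
Qed.

(** * The Pearson equation and the class *)

Lemma quartic_functional_pearson :
  pearson (quartic_functional z_gt0) 'X ((4 * z)%:C *: 'X^4 - 1).
Proof.
move=> p; rewrite /= /derive_functional /poly_mul_functional.
have := quartic_functional_deriv ('X * p).
rewrite hornerM hornerX mul0r oppr0 derivM derivX mul1r.
have -> : p + 'X * p^`() - (4 * z)%:C *: ('X^3 * ('X * p)) =
   'X * p^`() - ((4 * z)%:C *: 'X^4 - 1) * p.
  by rewrite -!mul_polyC; ring.
by rewrite raddfB /= => /eqP; rewrite subr_eq0 => /eqP ->; rewrite addNr.
Qed.

Lemma size_quartic_pearson : size ((4 * z)%:C *: 'X^4 - 1 : {poly R[i]}) = 5.
Proof.
have z0 : (4 * z)%:C != 0 :> R[i] by rewrite fmorph_eq0 mulf_neq0// gt_eqF.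
by rewrite size_polyDl size_scale// ?size_polyN ?size_poly1 size_polyXn.
Qed.

Lemma quartic_functional_pearson_pair :
  pearson_pair (quartic_functional z_gt0) 'X ((4 * z)%:C *: 'X^4 - 1).
Proof.
split; rewrite /deg ?size_quartic_pearson ?size_polyX ?polyX_eq0//.
  by rewrite -size_poly_gt0 size_quartic_pearson.
exact: quartic_functional_pearson.
Qed.

Lemma quartic_pearson_pair_size phi psi :
  pearson_pair (quartic_functional z_gt0) phi psi -> (5 <= size psi)%N.
Proof.
case=> phi0 psi0 _ _ H.
pose theta := psi + phi^`() - (4 * z)%:C *: ('X^3 * phi).
have thetaE p : quartic_functional z_gt0 (theta * p) = - phi.[0] * p.[0].
  have := H p; rewrite /= /derive_functional /poly_mul_functional => Hp.
  rewrite mulNr -hornerM -quartic_functional_deriv.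
  have -> : theta * p = (psi * p - phi * p^`()) +
     ((phi * p)^`() - (4 * z)%:C *: ('X^3 * (phi * p))).
    by rewrite /theta derivM -!mul_polyC; ring.
  by rewrite raddfD raddfB /= addrC [X in _ + X]addrC Hp addr0.
(* Testing against multiples of 'X removes the boundary term at 0. *)
have theta0 : theta = 0.
  have /eqP : theta * 'X = 0.
    apply: quartic_functional_nondegenerate => p.
    by rewrite -mulrA thetaE hornerM hornerX mul0r mulr0.
  by rewrite mulf_eq0 polyX_eq0 orbF => /eqP.
have phi_root : phi.[0] = 0.
  have := thetaE 1; rewrite theta0 mul0r hornerC mulr1 raddf0 => /esym/eqP.
  by rewrite oppr_eq0 => /eqP.
have size_phi : (1 < size phi)%N.
  by apply: (@root_size_gt1 _ 0) => //; apply/eqP.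
have -> : psi = (4 * z)%:C *: ('X^3 * phi) - phi^`().
  by move/eqP: theta0; rewrite subr_eq0 => /eqP <-; rewrite addrK.
have z0 : (4 * z)%:C != 0 :> R[i] by rewrite fmorph_eq0 mulf_neq0// gt_eqF.
have s3 : size ((4 * z)%:C *: ('X^3 * phi)) = (size phi + 3)%N.
  by rewrite size_scale// mulrC size_mulXn// addnC.
rewrite size_polyDl s3 ?size_polyN.
  by rewrite (leq_add2r 3 2).
by rewrite (leq_trans (lt_size_deriv phi0))// leq_addr.
Qed.
End Moment.

Theorem theorem3p1 (R : realType) (z : R) (hz : 0 < z) :
  [/\ semiclassical (quartic_functional hz),
      has_class (quartic_functional hz) 3 &
      pearson (quartic_functional hz) 'X ((4 * z)%:C *: 'X^4 - 1)].
Proof.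
have XP := quartic_functional_pearson_pair hz.
split; last exact: quartic_functional_pearson.
- split; first exact: quartic_functional_quasi_definite.
  by exists 'X, ((4 * z)%:C *: 'X^4 - 1).
- split.
    exists 'X, ((4 * z)%:C *: 'X^4 - 1); split=> //.
    (* Degrees 1 and 4 give the maximum of -1 and 3. *)
    by rewrite /pearson_order /deg size_polyX size_quartic_pearson.
  move=> phi psi /quartic_pearson_pair_size psi5.
  rewrite /pearson_order /deg le_max; apply/orP; right.
  by move: psi5; case: (size psi) => [|[|[|[|[|n]]]]]//.
Qed.
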